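(* Let $a\in\mathbb N$, $z\in\{1,\dots,a-1\}$, $p\in(0,1)$ and $q=1-p$. The ruin probability under geometric resetting with rate $\gamma\in(0,1)$ admits the closed-form spectral representation $$q_z(\gamma)=\frac{\displaystyle\sum_{\nu=1}^{a-1}A_\nu(z)\,f_\nu(\gamma)}{\displaystyle\sum_{\nu=1}^{a-1}\big[A_\nu(z)+B_\nu(z)\big]\,f_\nu(\gamma)},$$ where $$f_\nu(\gamma)=\frac{\lambda_\nu(1-\gamma)}{1-\lambda_\nu(1-\gamma)},\qquad \lambda_\nu=2\sqrt{pq}\,\cos\!\left(\frac{\pi\nu}{a}\right),$$ $$A_\nu(z)=\frac2a\left(\frac qp\right)^{z/2}\sin\!\left(\frac{\pi\nu z}{a}\right)\sin\!\left(\frac{\pi\nu}{a}\right),$$ $$B_\nu(z)=\frac2a\left(\frac pq\right)^{(a-z)/2}\sin\!\left(\frac{\pi\nu(a-z)}{a}\right)\sin\!\left(\frac{\pi\nu}{a}\right),\qquad \nu=1,\dots,a-1.$$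
   Context: The process: $(X_n)_{n\ge0}$ on $\{0,1,\dots,a\}$ starts at $X_0=z$. At each time step, independently of everything else, with probability $\gamma$ the walker is reset, $X_n=z$ (the same $z$ as the starting position), and with probability $1-\gamma$ it performs a step $X_n=X_{n-1}+\xi_n$ with $\mathbb P(\xi_n=+1)=p$, $\mathbb P(\xi_n=-1)=q$. Thus the times between successive resets are i.i.d. geometric: $\mathbb P(\sigma=k)=\gamma(1-\gamma)^{k-1}$, $k\ge1$. The process is absorbed upon first hitting $0$ or $a$. The ruin probability $q_z(\gamma)$ is the probability that the process started from (and reset to) $z$ is absorbed at $0$ before reaching $a$.
   Formalization: The formal theorem assumes also z ≠ 1 and z ≠ a−1; at these two starting points the displayed formula is false (a=3, z=1, p=1/2: the ruin probability is 2/(3−γ), the formula gives (1−γ)/(3−γ)) or, for a=2, reads 0/0. *)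

(* Defs.v *)
From HB Require Import structures.
From mathcomp Require Import all_boot all_order all_algebra.
From mathcomp Require Import all_classical all_reals all_analysis.

Set Implicit Arguments.
Unset Strict Implicit.
Unset Printing Implicit Defensive.

Import Order.TTheory GRing.Theory Num.Theory.
Import numFieldNormedType.Exports.

Local Open Scope classical_set_scope.
Local Open Scope ring_scope.

Definition sigma_of {d d' : measure_display} {T : measurableType d}
    {T' : measurableType d'} (X : T -> T') : set (set T) :=
  preimage_set_system setT X measurable.

(* Mutual independence of a family of sets of events: the product rule over
   every finite subfamily. *)
Definition mutually_independent {d : measure_display} {T : measurableType d}
    {R : realType} (P : probability T R) {I : choiceType}
    (F : I -> set (set T)) : Prop :=
  forall (s : seq I) (E : I -> set T), uniq s ->
    (forall i, i \in s -> F i (E i)) ->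
    P (\bigcap_(i in [set` s]) E i) = (\prod_(i <- s) P (E i))%E.

Section ResettingWalk.
Context {d : measure_display} {T : measurableType d} {R : realType}
  (P : probability T R).

(* The reset indicators rho_n and the increments xi_n are all mutually
   independent, with P(rho_n = true) = gamma, P(xi_n = 1) = p and
   P(xi_n = -1) = q. Both sequences are indexed from 0: rho_n and xi_n drive
   the passage from time n to time n + 1. *)
Definition reset_walk_inputs (gamma p q : R) (rho : nat -> {RV P >-> bool})
    (xi : nat -> {RV P >-> R}) : Prop :=
  [/\ mutually_independent P (fun i : nat + nat =>
        match i with
        | inl n => sigma_of (rho n)
        | inr n => sigma_of (xi n)
        end),
      forall n, P (rho n @^-1` [set true]) = gamma%:E,
      forall n, P (xi n @^-1` [set 1]) = p%:E &
      forall n, P (xi n @^-1` [set -1]) = q%:E].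

(* The position X_n, as a real number; it lies in {0, ..., a} almost surely. *)
Fixpoint reset_walk (a z : nat) (rho : nat -> {RV P >-> bool})
    (xi : nat -> {RV P >-> R}) (n : nat) (w : T) : R :=
  match n with
  | 0 => z%:R
  | m.+1 =>
      let x := reset_walk a z rho xi m w in
      if (x == 0) || (x == a%:R) then x
      else if rho m w then z%:R
      else x + xi m w
  end.

Definition ruin_event (a z : nat) (rho : nat -> {RV P >-> bool})
    (xi : nat -> {RV P >-> R}) : set T :=
  [set w | exists n, reset_walk a z rho xi n w = 0 /\
     forall m, (m < n)%N -> reset_walk a z rho xi m w <> a%:R].

End ResettingWalk.

Section SpectralTerms.
Context {R : realType}.
Implicit Types (a z nu : nat) (p q gamma : R).

Definition spec_lambda a p q nu : R :=
  2 * Num.sqrt (p * q) * cos (pi * nu%:R / a%:R).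

Definition spec_f a p q gamma nu : R :=
  spec_lambda a p q nu * (1 - gamma) /
  (1 - spec_lambda a p q nu * (1 - gamma)).

Definition spec_A a z p q nu : R :=
  2 / a%:R * ((q / p) `^ (z%:R / 2)) *
  sin (pi * nu%:R * z%:R / a%:R) * sin (pi * nu%:R / a%:R).

Definition spec_B a z p q nu : R :=
  2 / a%:R * ((p / q) `^ ((a%:R - z%:R) / 2)) *
  sin (pi * nu%:R * (a%:R - z%:R) / a%:R) * sin (pi * nu%:R / a%:R).

End SpectralTerms.

(* Main.v *)
Require Import Defs.
From HB Require Import structures.
From mathcomp Require Import all_boot all_order all_algebra.
From mathcomp Require Import all_classical all_reals all_analysis.
From mathcomp Require Import ring lra zify.

Import Order.TTheory GRing.Theory Num.Theory.
Import numFieldNormedType.Exports.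

Local Open Scope classical_set_scope.
Local Open Scope ring_scope.

(** Put s = 1 - gamma, and let h0 x and ha x be the discounted exit probabilities
    E[s^tau; exit at 0] and E[s^tau; exit at a] of the walk without resetting.
    Both are s-harmonic inside the grid, and conditioning on the first reset
    gives k = h0 z + (1 - h0 z - ha z) k for the ruin probability k.  To avoid
    stopping times, this is run backwards: phi = h0 + (1 - h0 - ha) k has a
    constant mean along the resetting chain and boundary values 1 and 0, while
    1 - h0 - ha loses the constant gamma (h0 z + ha z) at each step taken in the
    interior, so that the chain leaves the interior almost surely.

    The resolvent of the sine eigenfunctions makes h0 explicit: its terms carry
    1 / (1 - lambda s) = f + 1, and the summand 1 contributes a multiple of the
    Kronecker delta of z and 1, which vanishes for z > 1.  Exchanging p with q
    and x with a - x turns h0 into ha. *)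

(** * Cosine sums and orthogonality of the sine modes *)

Lemma two_sin_sum_cos (R : realType) (x : R) (n : nat) :
  2 * sin x * \sum_(nu < n) cos (nu%:R * (2 * x)) = sin ((2 * n%:R - 1) * x) + sin x.
Proof.
elim: n => [|n IHn].
  by rewrite big_ord0 !mulr0 add0r mulN1r sinN addNr.
rewrite big_ord_recr /= mulrDr IHn.
have -> : (2 * n.+1%:R - 1) * x = n%:R * (2 * x) + x by rewrite -natr1; ring.
have -> : (2 * n%:R - 1) * x = n%:R * (2 * x) - x by ring.
rewrite sinB sinD; ring.
Qed.

Lemma sin_natr_pi (R : realType) (k : nat) : sin (k%:R * pi) = 0 :> R.
Proof.
elim: k => [|k IHk]; first by rewrite mul0r sin0.
by rewrite -natr1 mulrDl mul1r sinDpi IHk oppr0.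
Qed.

Lemma cos_natr_pi (R : realType) (k : nat) : cos (k%:R * pi) = (-1) ^+ k :> R.
Proof.
elim: k => [|k IHk]; first by rewrite mul0r cos0.
by rewrite -natr1 mulrDl mul1r cosDpi IHk exprS mulN1r.
Qed.

(** This is the Dirichlet kernel at [x = k pi / (2 a)]; the bound [k < 2 * a] keeps [sin x]
    positive, so that it can be cancelled, and [(2 a - 1) x = k pi - x] evaluates the closed
    form. *)
Lemma sum_cos_natr_pi (R : realType) (a k : nat) : (0 < k < 2 * a)%N ->
  \sum_(nu < a) cos (pi * nu%:R * k%:R / a%:R) = (1 - (-1) ^+ k) / 2 :> R.
Proof.
move=> /andP[k0 ka].
have a_gt0 : (0 < a)%N by lia.
have a0 : (a%:R : R) != 0 by rewrite pnatr_eq0 -lt0n.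
pose x : R := k%:R * pi / (2 * a%:R).
have x0 : 0 < sin x.
  apply: sin_gt0_pi; rewrite /x; apply/andP; split.
    by rewrite divr_gt0 ?mulr_gt0 ?pi_gt0 ?ltr0n.
  rewrite ltr_pdivrMr ?mulr_gt0 ?ltr0n //.
  by rewrite mulrC ltr_pM2l ?pi_gt0 // -natrM ltr_nat.
have E : 2 * sin x * \sum_(nu < a) cos (pi * nu%:R * k%:R / a%:R) =
    sin ((2 * a%:R - 1) * x) + sin x.
  rewrite -two_sin_sum_cos; congr (_ * _); apply: eq_bigr => nu _.
  by congr cos; rewrite /x; field.
apply: (mulfI (lt0r_neq0 x0)).
move: E; have -> : (2 * a%:R - 1) * x = k%:R * pi - x by rewrite /x; field.
rewrite sinB sin_natr_pi cos_natr_pi => E.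
by apply: (mulfI (_ : (2 : R) != 0)); rewrite // !mulrA E; field.
Qed.

(** The product formula turns the sum into a difference of cosine sums at [x - 1] and [x + 1]. These
    frequencies have the same parity, so the sums cancel, except for [x = 1], where frequency 0
    contributes [a]. *)
Lemma sum_sin_sin_orthogonal (R : realType) (a x : nat) : (0 < x < a)%N ->
  \sum_(1 <= nu < a) 2 / a%:R * sin (pi * nu%:R * x%:R / a%:R) *
    sin (pi * nu%:R / a%:R) = (x == 1%N)%:R :> R.
Proof.
move=> /andP[x0 xa].
have a0 : (a%:R : R) != 0 by rewrite pnatr_eq0 -lt0n (leq_trans _ xa).
pose C k : R := \sum_(nu < a) cos (pi * nu%:R * k%:R / a%:R).
transitivity ((C x.-1 - C x.+1) / a%:R).
  rewrite /C -sumrB mulr_suml -(big_mkord xpredT (fun nu : nat =>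
    (cos (pi * nu%:R * x.-1%:R / a%:R) - cos (pi * nu%:R * x.+1%:R / a%:R)) / a%:R : R)).
  (* The cosine sums start at [nu = 0], where the difference of cosines vanishes. *)
  rewrite [RHS]big_ltn ?(leq_trans _ xa) //.
  rewrite mulr0 !mul0r subrr mul0r add0r; apply: eq_bigr => nu _.
  set u := pi * nu%:R * x%:R / a%:R; set v := pi * nu%:R / a%:R.
  have -> : pi * nu%:R * x.-1%:R / a%:R = u - v.
    by rewrite /u /v -[in RHS](prednK x0) -natr1; field.
  have -> : pi * nu%:R * x.+1%:R / a%:R = u + v.
    by rewrite /u /v -natr1; field.
  by rewrite cosB cosD; field.
have -> : C x.+1 = (1 - (-1) ^+ x.+1) / 2 by rewrite /C sum_cos_natr_pi //; lia.
case: x x0 xa => [//|[|x]] _ xa.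
  rewrite /C (eq_bigr (fun=> 1)) => [|i _]; last by rewrite mulr0 mul0r cos0.
  by rewrite sumr_const card_ord sqrrN expr1n subrr mul0r subr0 divff.
rewrite /C sum_cos_natr_pi; last by rewrite /=; lia.
by rewrite /= !exprS !mulN1r !opprK subrr mul0r.
Qed.

(** By the arithmetic-geometric mean inequality, [2 sqrt(pq) <= p + q = 1]. With [s < 1] this keeps
    every resolvent denominator positive. *)
Lemma spec_lambda_le1 (R : realType) (p q : R) (a nu : nat) :
  0 < p -> 0 < q -> p + q = 1 -> spec_lambda a p q nu <= 1.
Proof.
move=> p0 q0 pq1; rewrite /spec_lambda.
set t := Num.sqrt _; set c := cos _.
have t0 : 0 <= t by exact: sqrtr_ge0.
have c1 : c <= 1 by exact: cos_le1.
have t2 : t ^+ 2 = p * q by rewrite sqr_sqrtr // mulr_ge0 // ltW.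
have t1 : 2 * t <= 1.
  rewrite -(ler_pXn2r (n := 2)) ?nnegrE ?mulr_ge0 // exprMn t2 expr1n.
  have := sqr_ge0 (p - q); have -> : q = 1 - p by lra.
  by rewrite !expr2; nra.
by nra.
Qed.

(** * The sine resolvent and the explicit discounted ruin function *)

Section SpectralSolution.
Context {R : realType}.
Variables (a : nat) (p q s : R).
Hypotheses (p0 : 0 < p) (q0 : 0 < q) (pq1 : p + q = 1) (s01 : 0 < s < 1).

Let t : R := Num.sqrt (p * q).
Let r : R := Num.sqrt (q / p).
Let lam : nat -> R := spec_lambda a p q.

(** The entry [(x, 1)] of the inverse of [1 - s t J], where [J] is the adjacency matrix of the path
    [1, ..., a - 1]: the sines are its eigenvectors and [lam nu] the eigenvalues of [t J]. *)
Let resolvent (x : nat) : R := \sum_(1 <= nu < a)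
  2 / a%:R * sin (pi * nu%:R * x%:R / a%:R) * sin (pi * nu%:R / a%:R) /
  (1 - lam nu * s).

(* The value at 0 is the boundary condition E[s^0] = 1; the sine series vanishes there. *)
Definition discounted_ruin (x : nat) : R :=
  if x is 0 then 1 else t * s * r ^+ x * resolvent x.

Lemma spec_denom_neq0 (nu : nat) : 1 - lam nu * s != 0.
Proof.
have := spec_lambda_le1 R p q a nu p0 q0 pq1; rewrite -/(lam nu) => l1.
by have /andP[s0 s1] := s01; apply: lt0r_neq0; nra.
Qed.

Lemma resolvent0 : resolvent 0 = 0.
Proof. by apply: big1 => nu _; rewrite mulr0 mul0r sin0 mulr0 !mul0r. Qed.

Lemma resolvent_end : (0 < a)%N -> resolvent a = 0.
Proof.
move=> a0; apply: big1 => nu _.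
have -> : pi * nu%:R * a%:R / a%:R = nu%:R * pi :> R.
  by rewrite mulfK ?pnatr_eq0 -?lt0n // mulrC.
by rewrite sin_natr_pi mulr0 !mul0r.
Qed.

(** Each mode satisfies [sin(u + v) + sin(u - v) = 2 cos v sin u], so the neighbour sum multiplies
    it by [lam nu / t]. Then [1 / (1 - lam s) = lam s / (1 - lam s) + 1], and orthogonality sums the
    remaining 1 to the Kronecker delta. *)
Lemma resolvent_rec (x : nat) : (0 < x < a)%N ->
  resolvent x = s * t * (resolvent x.+1 + resolvent x.-1) + (x == 1%N)%:R.
Proof.
move=> xa; have /andP[x0 xlta] := xa.
have a0 : (a%:R : R) != 0 by rewrite pnatr_eq0 -lt0n; lia.
rewrite -(sum_sin_sin_orthogonal R a x xa) /resolvent -big_split mulr_sumr -big_split /=.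
apply: eq_bigr => nu _; have d0 := spec_denom_neq0 nu.
set u := pi * nu%:R * x%:R / a%:R; set v := pi * nu%:R / a%:R.
have -> : pi * nu%:R * x.-1%:R / a%:R = u - v.
  by rewrite /u /v -[in RHS](prednK x0) -natr1; field.
have -> : pi * nu%:R * x.+1%:R / a%:R = u + v.
  by rewrite /u /v -natr1; field.
rewrite sinB sinD.
move: d0; rewrite /lam /spec_lambda -/t -/v => d0; field.
by rewrite a0 d0.
Qed.

Lemma discounted_ruin_end : (0 < a)%N -> discounted_ruin a = 0.
Proof. by move=> a0; rewrite /discounted_ruin resolvent_end // mulr0; case: a a0. Qed.

(** The factor [r ^+ x] symmetrizes the biased walk, since [p r = t] and [q = t r]. At [x = 1] the
    delta of [resolvent_rec] contributes [t s r = s q], which is the boundary value 1 seen from its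
    neighbour. *)
Lemma discounted_ruin_rec (x : nat) : (0 < x < a)%N ->
  discounted_ruin x = s * (p * discounted_ruin x.+1 + q * discounted_ruin x.-1).
Proof.
move=> xa; have /andP[s0 s1] := s01.
have pr : p * r = t.
  rewrite /r /t -{1}(gtr0_norm p0) -sqrtr_sqr -sqrtrM ?sqr_ge0 //.
  by congr Num.sqrt; field; rewrite gt_eqF.
have tr : t * r = q.
  rewrite /r /t -sqrtrM ?mulr_ge0 ?ltW //.
  have -> : p * q * (q / p) = q ^+ 2 by field; rewrite gt_eqF.
  by rewrite sqrtr_sqr gtr0_norm.
have := resolvent_rec x xa; case: x xa => [//|x] xa E.
rewrite [LHS]/= E [discounted_ruin x.+2]/= [x.+1.-1]/= !exprS.
case: x {E xa} => [|x] /=.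
  by rewrite resolvent0 expr0 -tr -pr; ring.
by rewrite !exprS -tr -pr; ring.
Qed.

Lemma discounted_ruin_spec (x : nat) : (1 < x < a)%N ->
  discounted_ruin x =
  t * s * \sum_(1 <= nu < a) spec_A a x p q nu * spec_f a p q (1 - s) nu.
Proof.
move=> /andP[x1 xa]; have x0 : (0 < x)%N by lia.
have rx : (q / p) `^ (x%:R / 2) = r ^+ x.
  have qp0 : 0 <= q / p by rewrite divr_ge0 ?ltW.
  by rewrite (mulrC x%:R) powRrM powR12_sqrt ?powR_mulrn ?sqrtr_ge0.
have -> : discounted_ruin x = t * s * (r ^+ x * resolvent x).
  by case: x x0 {x1 xa rx} => // x _; rewrite mulrA.
have E : (\sum_(1 <= nu < a) 2 / a%:R * sin (pi * nu%:R * x%:R / a%:R) *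
    sin (pi * nu%:R / a%:R) : R) = 0.
  by rewrite sum_sin_sin_orthogonal ?x0 // gtn_eqF.
(* Subtracting the vanishing sum [E] replaces [1 / (1 - lam s)] by [lam s / (1 - lam s)],
   termwise. *)
congr (_ * _); rewrite -[resolvent x]subr0 -[X in _ - X]E /resolvent -sumrB mulr_sumr.
apply: eq_bigr => nu _; have d0 := spec_denom_neq0 nu.
rewrite /spec_A rx /spec_f subKr -/(lam nu).
by field; rewrite d0 pnatr_eq0; lia.
Qed.
End SpectralSolution.

(** Minimum principle: a negative interior minimum [m] would satisfy [m >= s m > m]. Once [w] is
    nonnegative, strict positivity spreads from 0 to the right through the term [q * w x.-1]. *)
Lemma discounted_harmonic_gt0 (R : realType) (a : nat) (p q s : R) (w : nat -> R) :
  0 < p -> 0 < q -> p + q = 1 -> 0 < s < 1 -> 0 < w 0%N -> 0 < w a ->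
  (forall x, (0 < x < a)%N -> w x = s * (p * w x.+1 + q * w x.-1)) ->
  forall x, (x <= a)%N -> 0 < w x.
Proof.
move=> p0 q0 pq1 /andP[s0 s1] w0 wa wrec.
have wge0 x : (x <= a)%N -> 0 <= w x.
  move=> xa; pose i := [arg min_(j < (ord0 : 'I_a.+1)) w j]%O.
  have imin (y : nat) : (y <= a)%N -> w i <= w y.
    move=> ya; rewrite /i; case: arg_minP => //= j _ /(_ (Ordinal (ya : (y < a.+1)%N))).
    exact.
  apply: le_trans (imin x xa); rewrite leNgt; apply/negP => wi.
  have i0 : (0 < i)%N by rewrite lt0n; apply: contraTN wi => /eqP ->; rewrite -leNgt ltW.
  have ia : (i < a)%N.
    rewrite ltn_neqAle -ltnS ltn_ord andbT; apply: contraTN wi => /eqP ->.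
    by rewrite -leNgt ltW.
  have := wrec i; rewrite i0 ia => /(_ isT) wE.
  have A := imin i.+1 ia; have B : w i <= w i.-1 by apply: imin; lia.
  have : w i <= p * w i.+1 + q * w i.-1.
    have -> : w i = p * w i + q * w i by rewrite -mulrDl pq1 mul1r.
    by rewrite lerD ?ler_pM2l.
  by move: wE; set y := p * _ + _ => wE wy; nra.
elim=> [//|x IHx xa]; have [->//|xna] := eqVneq x.+1 a.
rewrite wrec /=; last by lia.
have A : 0 <= w x.+2 by apply: wge0; lia.
have B : 0 < w x by apply: IHx; lia.
by rewrite mulr_gt0 // ltr_wpDl ?mulr_ge0 ?mulr_gt0 // ltW.
Qed.

(** * The absorbed resetting chain and its limiting mass at 0 *)

Section AbsorbedChain.
Context {R : realType}.
Variables (a z : nat) (p gamma : R).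
Hypotheses (za : (0 < z < a)%N) (p01 : 0 < p < 1) (gamma01 : 0 < gamma < 1).

Let q := 1 - p.
Let s := 1 - gamma.

Definition bernoulli_weight (u : R) (b : bool) : R := if b then u else 1 - u.

(** Past the boundary test all arguments of [inord] are at most [a] when [z] is, so its default
    value is never met. A direction bit is supplied even at a reset, which keeps the inputs a plain
    product. *)
Definition chain_step (x : 'I_a.+1) (reset up : bool) : 'I_a.+1 :=
  if (x == 0%N :> nat) || (x == a :> nat) then x
  else if reset then inord z else inord (if up then x.+1 else x.-1).

(** The forward equation for the law of the chain, summed over triples of position and bits to match
    the partition by [joint] below. *)
Fixpoint occupation (n : nat) : 'I_a.+1 -> R :=
  match n with
  | 0 => fun y => (y == inord z)%:R
  | m.+1 => fun y => \sum_(t : 'I_a.+1 * bool * bool |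
      chain_step t.1.1 t.1.2 t.2 == y)
      occupation m t.1.1 * bernoulli_weight gamma t.1.2 * bernoulli_weight p t.2
  end.

Definition occupation_mean (n : nat) (phi : nat -> R) : R :=
  \sum_(x : 'I_a.+1) occupation n x * phi x.

Definition transition (phi : nat -> R) (x : nat) : R :=
  if (x == 0%N) || (x == a) then phi x
  else gamma * phi z + s * (p * phi x.+1 + q * phi x.-1).

Definition interior_indicator (x : nat) : R := (0 < x < a)%N%:R.

Lemma occupation_mean0 (phi : nat -> R) : occupation_mean 0 phi = phi z.
Proof.
rewrite /occupation_mean (bigD1 (inord z)) //= eqxx mul1r inordK; last by lia.
by rewrite big1 ?addr0 // => i /negbTE ->; rewrite mul0r.
Qed.

(** Duality of the forward and backward equations: it reduces every later computation of a mean to a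
    pointwise identity or inequality for [transition]. *)
Lemma occupation_meanS (n : nat) (phi : nat -> R) :
  occupation_mean n.+1 phi = occupation_mean n (transition phi).
Proof.
rewrite /occupation_mean /=.
under eq_bigr do rewrite mulr_suml.
transitivity (\sum_(t : 'I_a.+1 * bool * bool)
    occupation n t.1.1 * bernoulli_weight gamma t.1.2 * bernoulli_weight p t.2 *
    phi (chain_step t.1.1 t.1.2 t.2)).
  rewrite [RHS](partition_big (fun t => chain_step t.1.1 t.1.2 t.2) xpredT) //=.
  by apply: eq_bigr => y _; apply: eq_bigr => t /eqP ->.
rewrite -(pair_bigA _ (fun xb e => occupation n xb.1 * bernoulli_weight gamma xb.2 *
  bernoulli_weight p e * phi (chain_step xb.1 xb.2 e))) /=.
rewrite -(pair_bigA _ (fun x b => \sum_e occupation n x * bernoulli_weight gamma b *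
  bernoulli_weight p e * phi (chain_step x b e))) /=.
apply: eq_bigr => x _; rewrite !big_bool /bernoulli_weight /chain_step /transition /=.
case: ifPn => [_|]; first by rewrite /s /q; ring.
rewrite negb_or => /andP[x0 xa]; have := ltn_ord x => xlt.
rewrite !inordK; [|lia..]. by rewrite /s /q; ring.
Qed.

Lemma occupation_ge0 (n : nat) (x : 'I_a.+1) : 0 <= occupation n x.
Proof.
have /andP[p0 p1] := p01; have /andP[g0 g1] := gamma01.
elim: n x => [|n IHn] x /=; first by rewrite ler0n.
apply: sumr_ge0 => t _; rewrite !mulr_ge0 //.
  by rewrite /bernoulli_weight; case: ifP => _; lra.
by rewrite /bernoulli_weight; case: ifP => _; lra.
Qed.

Lemma occupation_mean1 (n : nat) : occupation_mean n (fun=> 1) = 1.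
Proof.
elim: n => [|n IHn]; first by rewrite occupation_mean0.
rewrite occupation_meanS -[RHS]IHn; congr occupation_mean; apply/funext => x.
by rewrite /transition; case: ifP => // _; rewrite /s /q; ring.
Qed.

Lemma ler_occupation_mean (n : nat) (phi psi : nat -> R) :
  (forall x, (x <= a)%N -> phi x <= psi x) -> occupation_mean n phi <= occupation_mean n psi.
Proof.
move=> le; apply: ler_sum => x _; rewrite ler_wpM2l ?occupation_ge0 // le //.
by rewrite -ltnS.
Qed.

Lemma occupation_mean_lin (n : nat) (phi psi : nat -> R) (c : R) :
  occupation_mean n (fun x => phi x + c * psi x) =
  occupation_mean n phi + c * occupation_mean n psi.
Proof.
rewrite /occupation_mean mulr_sumr -big_split; apply: eq_bigr => x _ /=.
by ring.
Qed.

Lemma grid_bounded (phi : nat -> R) :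
  exists2 M, 0 <= M & forall x, (x <= a)%N -> `|phi x| <= M.
Proof.
exists (\sum_(x : 'I_a.+1) `|phi x|); first exact: sumr_ge0.
move=> x xa; rewrite (bigD1 (Ordinal (xa : (x < a.+1)%N))) //= lerDl.
exact: sumr_ge0.
Qed.

(** The ends are absorbing, so the indicator of the interior is superharmonic. *)
Lemma occupation_interior_nincr (n : nat) :
  occupation_mean n.+1 interior_indicator <= occupation_mean n interior_indicator.
Proof.
have /andP[p0 p1] := p01; have /andP[g0 g1] := gamma01.
rewrite occupation_meanS; apply: ler_occupation_mean => x xa.
have i01 y : 0 <= interior_indicator y <= 1 by rewrite /interior_indicator ler0n lern1 leq_b1.
have /andP[A0 A1] := i01 z; have /andP[B0 B1] := i01 x.+1; have /andP[C0 C1] := i01 x.-1.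
rewrite /transition; case: ifPn => // /norP[x0 xna].
have -> : interior_indicator x = 1 by rewrite /interior_indicator; have -> : (0 < x < a)%N by lia.
have D : p * interior_indicator x.+1 + q * interior_indicator x.-1 <= 1 by rewrite /q; nra.
by rewrite /s; move: D; set y := p * _ + _ => D; nra.
Qed.

(* [w] is the discounted exit function, so [1 - w] loses exactly [gamma * w z]
   on average at every step taken in the interior; being bounded, it allows
   only a finite expected time there. *)
Lemma occupation_interior_le (w : nat -> R) :
  0 < w z ->
  (forall x, (0 < x < a)%N -> w x = s * (p * w x.+1 + q * w x.-1)) ->
  exists2 C, 0 <= C & forall n, occupation_mean n interior_indicator <= C * n.+1%:R^-1.
Proof.
move=> wz wrec; have /andP[g0 g1] := gamma01.
pose v x := 1 - w x.
have step n : occupation_mean n.+1 v =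
    occupation_mean n v - gamma * w z * occupation_mean n interior_indicator.
  rewrite occupation_meanS -mulNr -occupation_mean_lin; apply: eq_bigr => x _.
  congr (_ * _); rewrite /transition /interior_indicator; have := ltn_ord x => xlt.
  case: ifPn => [|/norP[x0 xna]].
    move=> x0a; have -> : (0 < x < a)%N = false by lia.
    by rewrite mulr0n mulr0 addr0.
  have xint : (0 < x < a)%N by lia.
  by rewrite xint mulr1n mulr1 /v (wrec x xint) /q /s; ring.
have sumE n : gamma * w z * \sum_(i < n) occupation_mean i interior_indicator =
    v z - occupation_mean n v.
  elim: n => [|n IHn]; first by rewrite big_ord0 mulr0 occupation_mean0 subrr.
  by rewrite big_ord_recr /= mulrDr IHn step; ring.
have gw : 0 < gamma * w z by rewrite mulr_gt0.
have [M M0 vM] := grid_bounded v.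
have meanM n : - M <= occupation_mean n v.
  rewrite -[- M]mulr1 -(occupation_mean1 n) /occupation_mean mulr_sumr.
  apply: ler_sum => x _; rewrite mulr1 mulrC ler_wpM2l ?occupation_ge0 //.
  have /vM : (x <= a)%N by rewrite -ltnS.
  by rewrite ler_norml => /andP[].
(* The telescoped drift is at most [2 * M], and the means do not increase, so the last of [n.+1] of
   them is at most their average. *)
exists (2 * M / (gamma * w z)); first by rewrite divr_ge0 ?mulr_ge0 // ltW.
move=> n; rewrite ler_pdivlMr ?ltr0n // ler_pdivlMr // mulrC.
have -> : 2 * M = M + M by ring.
apply: (@le_trans _ _ (v z - occupation_mean n.+1 v)); last first.
  have /vM : (z <= a)%N by lia.
  by rewrite ler_norml => /andP[_ vz]; have := meanM n.+1; lra.
rewrite -sumE ler_pM2l // mulr_natr -[X in _ *+ X]card_ord -sumr_const.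
have mono : {homo (fun n => occupation_mean n interior_indicator) : m k / (m <= k)%N >-> k <= m}.
  apply: homo_leq => // [m k l km lm|m]; first exact: le_trans lm km.
  exact: occupation_interior_nincr.
by apply: ler_sum => i _; apply: mono; rewrite -ltnS.
Qed.

Lemma occupation_ruin_cvg (h0 ha : nat -> R) :
  h0 0%N = 1 -> h0 a = 0 -> ha 0%N = 0 -> ha a = 1 ->
  (forall x, (0 < x < a)%N -> h0 x = s * (p * h0 x.+1 + q * h0 x.-1)) ->
  (forall x, (0 < x < a)%N -> ha x = s * (p * ha x.+1 + q * ha x.-1)) ->
  (fun n => occupation n ord0) @ \oo --> h0 z / (h0 z + ha z).
Proof.
move=> h00 h0a ha0 haa h0rec harec.
have /andP[p0 p1] := p01; have /andP[g0 g1] := gamma01.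
pose w x := h0 x + ha x.
have wrec x : (0 < x < a)%N -> w x = s * (p * w x.+1 + q * w x.-1).
  by move=> xa; rewrite /w (h0rec x xa) (harec x xa); ring.
have wz : 0 < w z.
  apply: (discounted_harmonic_gt0 R a p q s w); rewrite /w ?h00 ?h0a ?ha0 ?haa /q /s //; try lra.
  by lia.
set k := h0 z / _.
(* The constant [k] solves [k = h0 z + (1 - w z) * k], that is [phi z = k]; a reset therefore
   contributes [gamma * k], exactly what makes [phi] invariant under [transition]. *)
pose phi x := h0 x + (1 - w x) * k.
have phiz : phi z = k.
  by rewrite /phi /k -/(w z); field; rewrite gt_eqF.
have phi_mean n : occupation_mean n phi = k.
  elim: n => [|n IHn]; first by rewrite occupation_mean0.
  rewrite occupation_meanS -IHn; apply: eq_bigr => x _; congr (_ * _).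
  rewrite /transition; have := ltn_ord x => xlt; case: ifPn => // /norP[x0 xna].
  have xint : (0 < x < a)%N by lia.
  by rewrite phiz /phi (h0rec x xint) (wrec x xint) /q /s; ring.
have [M M0 phiM] := grid_bounded phi.
have [C C0 intC] := occupation_interior_le w wz wrec.
(* As [phi] is 1 at 0 and 0 at [a], its constant mean differs from the mass at 0 only by the
   interior part, which decays like [1 / (n + 1)]. *)
have dist n : `|occupation n ord0 - k| <= M * C * n.+1%:R^-1.
  rewrite distrC -(phi_mean n).
  have -> : occupation_mean n phi - occupation n ord0 =
      \sum_(x : 'I_a.+1) occupation n x * (interior_indicator x * phi x).
    rewrite /occupation_mean big_ord_recl [RHS]big_ord_recl.
    rewrite {1}/phi /w h00 ha0 /interior_indicator /= addr0 subrr mul0r addr0 mulr1 mul0r mulr0.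
    rewrite addrC addKr add0r; apply: eq_bigr => x _; congr (_ * _).
    have [xa|xna] := ltnP (bump 0 x) a; first by rewrite mul1r.
    have -> : bump 0 x = a by have := ltn_ord x; rewrite /bump /= in xna *; lia.
    by rewrite /phi /w h0a haa !add0r subrr !mul0r.
  apply: le_trans (ler_norm_sum _ _ _) _.
  rewrite -mulrA; apply: le_trans (ler_wpM2l M0 (intC n)).
  rewrite /occupation_mean mulr_sumr; apply: ler_sum => x _.
  rewrite !normrM (ger0_norm (occupation_ge0 n x)) [leRHS]mulrCA ler_wpM2l ?occupation_ge0 //.
  by rewrite ger0_norm ?ler0n // mulrC ler_wpM2r ?ler0n // phiM // -ltnS ltn_ord.
apply/cvgrPdist_le => e e0.
have : (fun n => M * C * n.+1%:R^-1 : R) @ \oo --> (M * C * 0 : R).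
  by apply: cvgMl_tmp; exact: cvg_harmonic.
rewrite mulr0 => /cvgr0Pnorm_le /(_ e e0); apply: filterS => n le.
rewrite distrC (le_trans (dist n)) // (le_trans _ le) // ler_norm //.
Qed.

End AbsorbedChain.

(** * The law of the walk on the probability space *)

Lemma measure_finite_partition (d : measure_display) (T : measurableType d) (R : realType)
  (P : {measure set T -> \bar R}) (I : finType) (f : T -> I) (A : set T) :
  measurable A -> (forall i, measurable (f @^-1` [set i])) ->
  P A = (\sum_i P (A `&` f @^-1` [set i]))%E.
Proof.
move=> mA mf.
rewrite (@fsbig_seq _ _ _ _ (index_enum I)) ?index_enum_uniq // -measure_fin_bigcup //.
- congr (P _); rewrite -setI_bigcupr; apply/seteqP; split=> [w Aw|w []//].
  by split=> //; exists (f w) => //=; rewrite mem_index_enum.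
- by move=> i j _ _ [w [[_ <-] [_ <-]]].
- by move=> i _; exact: measurableI.
Qed.

Lemma measure_setI_conull (d : measure_display) (T : measurableType d) (R : realType)
  (P : probability T R) (A G : set T) :
  measurable A -> measurable G -> P (~` G) = 0%E -> P (A `&` G) = P A.
Proof.
move=> mA mG G0; rewrite [RHS](measureDI P mA mG).
rewrite [X in (X + _)%E](_ : _ = 0%E) ?add0e //.
apply/eqP; rewrite eq_le measure_ge0 andbT -G0; apply: le_measure.
- by rewrite inE; apply: measurableD.
- by rewrite inE; apply: measurableC.
- by move=> w [].
Qed.

Section WalkDistribution.
Context {R : realType} {d : measure_display} {T : measurableType d} (P : probability T R).
Variables (a z : nat) (p gamma : R).
Hypothesis za : (0 < z < a)%N.
Variables (rho : nat -> {RV P >-> bool}) (xi : nat -> {RV P >-> R}).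
Hypothesis inputs : reset_walk_inputs gamma p (1 - p) rho xi.

Let up (n : nat) (w : T) : bool := xi n w == 1.

(* A version of [reset_walk] with values in a finite type and fed with the bits
   [xi n w == 1]; the two agree wherever all increments are [1] or [-1]. *)
Fixpoint grid_walk (n : nat) (w : T) : 'I_a.+1 :=
  match n with
  | 0 => inord z
  | m.+1 => chain_step a z (grid_walk m w) (rho m w) (up m w)
  end.

Let input_events (i : nat + nat) : set (set T) :=
  match i with inl n => sigma_of (rho n) | inr n => sigma_of (xi n) end.

Let input_time (i : nat + nat) : nat := match i with inl n => n | inr n => n end.

Lemma input_events_measurable (i : nat + nat) (A : set T) : input_events i A -> measurable A.
Proof. by case: i => n [B mB <-]; rewrite setTI; exact: measurable_funPTI. Qed.

Lemma input_events_reset (n : nat) (b : bool) : input_events (inl n) (rho n @^-1` [set b]).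
Proof. by exists [set b] => //; rewrite setTI. Qed.

Lemma input_events_up (n : nat) (e : bool) : input_events (inr n) (up n @^-1` [set e]).
Proof.
exists (if e then [set 1] else ~` [set 1]).
  by case: e => //; apply: measurableC.
rewrite setTI; apply/seteqP; split=> w; rewrite /up /preimage /=.
  by case: e => [->|/eqP/negbTE]; rewrite ?eqxx.
by case: e => [/eqP|/negbT/eqP].
Qed.

Lemma probability_reset (n : nat) (b : bool) :
  P (rho n @^-1` [set b]) = (bernoulli_weight gamma b)%:E.
Proof.
have [_ rhoP _ _] := inputs; case: b => /=; first exact: rhoP.
rewrite (_ : _ @^-1` _ = ~` (rho n @^-1` [set true])).
  by rewrite probability_setC ?rhoP //; exact: measurable_funPTI.
by apply/seteqP; split=> w; rewrite /preimage /=; case: (rho n w).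
Qed.

Lemma probability_up (n : nat) (e : bool) :
  P (up n @^-1` [set e]) = (bernoulli_weight p e)%:E.
Proof.
have [_ _ xiP _] := inputs.
have upE : up n @^-1` [set true] = xi n @^-1` [set 1].
  by apply/seteqP; split=> w /eqP.
case: e => /=; first by rewrite upE xiP.
rewrite (_ : _ @^-1` _ = ~` (up n @^-1` [set true])).
  by rewrite upE probability_setC ?xiP //; exact: measurable_funPTI.
by apply/seteqP; split=> w; rewrite /preimage /=; case: (up n w).
Qed.

Let joint (n : nat) (w : T) : 'I_a.+1 * bool * bool := (grid_walk n w, rho n w, up n w).

Lemma joint_preimage (n : nat) (x : 'I_a.+1) (b e : bool) :
  joint n @^-1` [set (x, b, e)] =
  grid_walk n @^-1` [set x] `&` rho n @^-1` [set b] `&` up n @^-1` [set e].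
Proof.
by apply/seteqP; split=> w; rewrite /joint /preimage /=; [case=> -> -> ->|move=> [[-> ->] ->]].
Qed.

Lemma grid_walk_measurable (n : nat) (x : 'I_a.+1) : measurable (grid_walk n @^-1` [set x]).
Proof.
elim: n x => [|n IHn] y.
  rewrite (_ : _ @^-1` _ = if inord z == y then setT else set0); first by case: ifP.
  by apply/seteqP; split=> w; rewrite /preimage /=; case: eqP.
rewrite (_ : _ @^-1` _ = \bigcup_(t in [set t | chain_step a z t.1.1 t.1.2 t.2 = y])
    joint n @^-1` [set t]).
  apply: fin_bigcup_measurable; first exact: finite_finset.
  move=> [[x b] e] _; rewrite joint_preimage.
  apply: measurableI; first apply: measurableI => //.
    exact: (input_events_measurable _ _ (input_events_reset n b)).
  exact: (input_events_measurable _ _ (input_events_up n e)).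
apply/seteqP; split=> w; rewrite /preimage /=.
  by move=> <-; exists (joint n w).
by move=> [t /= <- <-].
Qed.

Lemma joint_measurable (n : nat) (t : 'I_a.+1 * bool * bool) :
  measurable (joint n @^-1` [set t]).
Proof.
case: t => [[x b] e]; rewrite joint_preimage.
apply: measurableI; first apply: measurableI; first exact: grid_walk_measurable.
  exact: (input_events_measurable _ _ (input_events_reset n b)).
exact: (input_events_measurable _ _ (input_events_up n e)).
Qed.

(* The position at time n is independent of the inputs from time n on; carrying
   this along in the induction is what makes the walk a Markov chain. *)
Lemma grid_walk_independent (n : nat) (x : 'I_a.+1) (s : seq (nat + nat))
    (E : nat + nat -> set T) :
  uniq s -> (forall i, i \in s -> (n <= input_time i)%N) ->
  (forall i, i \in s -> input_events i (E i)) ->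
  P (grid_walk n @^-1` [set x] `&` \bigcap_(i in [set` s]) E i) =
  ((occupation a z p gamma n x)%:E * \prod_(i <- s) P (E i))%E.
Proof.
have [indep _ _ _] := inputs.
elim: n x s E => [|n IHn] y s E us ts Es.
  rewrite /=; have [->|yz] := eqVneq y (inord z).
    rewrite mul1e -(indep s E us Es); congr (P _).
    by apply/seteqP; split=> w // [].
  rewrite mul0e (_ : _ `&` _ = set0) ?measure0 //.
  by apply/seteqP; split=> w //= [/esym/eqP]; rewrite (negbTE yz).
have mC : measurable (\bigcap_(i in [set` s]) E i).
  apply: fin_bigcap_measurable; first exact: finite_seq.
  by move=> i /Es /input_events_measurable.
(* The product is a finite real, so the sum over triples can be computed in [R]. *)
have [c cE] : exists c : R, (\prod_(i <- s) P (E i))%E = c%:E.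
  by rewrite -(indep s E us Es); exists (fine (P (\bigcap_(i in [set` s]) E i)));
     rewrite fineK // fin_num_measure.
rewrite (measure_finite_partition _ _ _ P _ (joint n)); last exact: joint_measurable.
  rewrite cE /= -EFinM mulr_suml -sumEFin [RHS]big_mkcond; apply: eq_bigr => t _ /=.
  case: ifPn => [/eqP yE|yE]; last first.
    rewrite (_ : _ `&` _ = set0) ?measure0 //.
    apply/seteqP; split=> w //= [[/= Yw _] tE].
    by move: yE; rewrite -tE -Yw eqxx.
  case: t yE => [[x b] e] /= yE.
  (* The two inputs of time [n] are added to the family. They are not in [s], whose times all exceed
     [n], so [E'] agrees with [E] there and the induction hypothesis applies to [s']. *)
  pose E' i := if i == inl n then rho n @^-1` [set b]
    else if i == inr n then up n @^-1` [set e] else E i.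
  pose s' : seq (nat + nat) := [:: inl n, inr n & s].
  have ns : (inl n \notin s) && (inr n \notin s).
    by apply/andP; split; apply/negP => /ts; rewrite ltnn.
  have /andP[nl nr] := ns.
  have E's i : i \in s -> E' i = E i.
    move=> si; rewrite /E'; case: eqP => [ii|_]; first by rewrite -ii si in nl.
    by case: eqP => [ii|//]; rewrite -ii si in nr.
  transitivity (P (grid_walk n @^-1` [set x] `&` \bigcap_(i in [set` s']) E' i)).
    congr (P _); rewrite joint_preimage; apply/seteqP; split=> w.
      move=> [[_ Ew] [[Yw rw] uw]]; split=> // i; rewrite /= !inE.
      move=> /or3P[/eqP->|/eqP->|si]; [by rewrite /E' eqxx|by rewrite /E' /= eqxx|].
      by rewrite E's //; exact: Ew.
    move=> [Yw Ew]; have rw : (rho n @^-1` [set b]) w.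
      by have := Ew (inl n); rewrite /E' eqxx; apply; rewrite /= inE eqxx.
    have uw : (up n @^-1` [set e]) w.
      by have := Ew (inr n); rewrite /E' eqxx /=; apply; rewrite /= !inE eqxx.
    split; last by split; first split.
    split; last by move=> i si; rewrite -E's //; apply: Ew; rewrite /= !inE [_ \in s]si !orbT.
    by rewrite /preimage /=; move: Yw rw uw; rewrite /preimage /= => -> -> ->.
  rewrite (IHn x s' E'); first last.
  - move=> i; rewrite !inE => /or3P[/eqP->|/eqP->|si]; rewrite /E' ?eqxx /=.
    + exact: input_events_reset.
    + exact: input_events_up.
    + by rewrite -/(E' i) E's //; exact: Es.
  - by move=> i; rewrite !inE => /or3P[/eqP->|/eqP->|/ts/ltnW].
  - by rewrite /s' /= !inE /= nl nr us.
  rewrite !big_cons [E' (inl n)]/= [E' (inr n)]/=.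
  rewrite {1 2}/E' !eqxx /= probability_reset probability_up.
  by rewrite (eq_big_seq (fun i => P (E i))) => [|i /E's ->//]; rewrite cE -!EFinM !mulrA.
apply: measurableI => //; exact: grid_walk_measurable.
Qed.

Lemma probability_grid_walk (n : nat) (x : 'I_a.+1) :
  P (grid_walk n @^-1` [set x]) = (occupation a z p gamma n x)%:E.
Proof.
have := grid_walk_independent n x [::] (fun=> setT) isT.
rewrite big_nil mule1 => <- //; congr (P _).
by apply/seteqP; split=> w // [].
Qed.

Lemma reset_walk_grid (n : nat) (w : T) :
  (forall m, xi m w = 1 \/ xi m w = -1) -> reset_walk a z rho xi n w = (grid_walk n w)%:R.
Proof.
move=> xiw; elim: n => [|n IHn] /=; first by rewrite inordK //; lia.
rewrite IHn pnatr_eq0 eqr_nat /chain_step; case: ifPn => // /norP[x0 xa].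
have xlt := ltn_ord (grid_walk n w).
case: ifP => _; first by rewrite inordK //; lia.
rewrite /up; have [xi1|xi1] := xiw n; rewrite xi1.
  by rewrite eqxx inordK ?natr1 //; lia.
have -> : (-1 == 1 :> R) = false by apply/negbTE; rewrite lt_eqF //; lra.
rewrite inordK; last by lia.
by rewrite -[in LHS](prednK (_ : 0 < grid_walk n w)%N) ?lt0n // -natr1 addrK.
Qed.

Lemma reset_walk_measurable (n : nat) : measurable_fun setT (reset_walk a z rho xi n).
Proof.
elim: n => [|n IHn] /=; first exact: measurable_cst.
apply: measurable_fun_ifT => //.
  by apply: measurable_or; apply: measurable_realfun.measurable_fun_eqr => //; exact: measurable_cst.
apply: measurable_fun_ifT => //.
exact: measurable_realfun.measurable_funD.
Qed.

(** Absorption freezes the walk at [a], which is nonzero, so a walk found at 0 has not met [a]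
    earlier. *)
Lemma ruin_event_bigcup :
  ruin_event a z rho xi = \bigcup_n (reset_walk a z rho xi n @^-1` [set 0]).
Proof.
apply/seteqP; split=> w; first by move=> [n [nw _]]; exists n.
move=> [n _ nw]; exists n; split=> // m mn mw.
have aw k : reset_walk a z rho xi (m + k) w = a%:R.
  elim: k => [|k IHk]; first by rewrite addn0.
  by rewrite addnS /= IHk eqxx orbT.
have := aw (n - m)%N; rewrite subnKC ?(ltnW mn) // nw => /esym/eqP.
by rewrite pnatr_eq0; lia.
Qed.

Lemma ruin_event_measurable : measurable (ruin_event a z rho xi).
Proof.
rewrite ruin_event_bigcup; apply: bigcupT_measurable => n.
by rewrite -[X in measurable X]setTI; exact: reset_walk_measurable.
Qed.

(** On this almost sure event the real-valued walk and [grid_walk] coincide at all times. *)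
Let unit_steps : set T :=
  \bigcap_m (xi m @^-1` [set 1] `|` xi m @^-1` [set -1]).

Lemma unit_steps_measurable : measurable unit_steps.
Proof.
by apply: bigcapT_measurable => m; apply: measurableU; exact: measurable_funPTI.
Qed.

Lemma unit_steps_conull : P (~` unit_steps) = 0%E.
Proof.
have [_ _ xi1 xiN1] := inputs.
apply/negligibleP; first exact: measurableC unit_steps_measurable.
rewrite setC_bigcap; apply: negligible_bigcup => m.
have mU : measurable (xi m @^-1` [set 1] `|` xi m @^-1` [set -1]).
  by apply: measurableU; exact: measurable_funPTI.
have U0 : P (~` (xi m @^-1` [set 1] `|` xi m @^-1` [set -1])) = 0%E; last first.
  by apply/negligibleP => //; exact: measurableC.
have PU : P (xi m @^-1` [set 1] `|` xi m @^-1` [set -1]) = (p%:E + (1 - p)%:E)%E.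
  rewrite -(xi1 m) -(xiN1 m).
  apply: measureU; [exact: measurable_funPTI..|].
  by apply/seteqP; split=> w //= [->]; lra.
by rewrite probability_setC // PU -!EFinD addrCA subrr addr0 subrr.
Qed.

(** Since 0 is absorbing, the events [hit n] increase, and continuity from below gives the limit.
    Their union agrees with the ruin event on [unit_steps]. *)
Lemma probability_ruin_cvg :
  (fun n => (occupation a z p gamma n ord0)%:E) @ \oo --> P (ruin_event a z rho xi).
Proof.
pose hit n := grid_walk n @^-1` [set ord0].
have mhit n : measurable (hit n) by exact: grid_walk_measurable.
have mH : measurable (\bigcup_n hit n) by exact: bigcupT_measurable.
have -> : P (ruin_event a z rho xi) = P (\bigcup_n hit n).
  rewrite -(measure_setI_conull _ _ _ P _ unit_steps ruin_event_measurable
    unit_steps_measurable unit_steps_conull).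
  rewrite -[RHS](measure_setI_conull _ _ _ P _ unit_steps mH
    unit_steps_measurable unit_steps_conull).
  congr (P _); rewrite ruin_event_bigcup; apply/seteqP; split=> w [[n _ nw] Gw];
    split=> //; exists n => //; move: nw; have E := reset_walk_grid n w (fun m => Gw m I);
    rewrite /hit /preimage /= E.
    by move/eqP; rewrite pnatr_eq0 => /eqP ?; exact: val_inj.
  by move=> ->.
have -> : (fun n => (occupation a z p gamma n ord0)%:E) = P \o hit.
  by apply/funext => n /=; rewrite probability_grid_walk.
apply: nondecreasing_cvg_mu => //.
apply/nondecreasing_seqP => n; apply/subsetPset => w; rewrite /hit /preimage /= => ->.
by rewrite /chain_step.
Qed.

End WalkDistribution.

(** * Reflection symmetry and the closed form *)

Lemma spec_B_reflect (R : realType) (a z : nat) (p q : R) (nu : nat) :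
  (z <= a)%N -> spec_B a z p q nu = spec_A a (a - z) q p nu.
Proof. by move=> za; rewrite /spec_B /spec_A natrB. Qed.

Lemma spec_f_swap (R : realType) (a : nat) (p q gamma : R) (nu : nat) :
  spec_f a p q gamma nu = spec_f a q p gamma nu.
Proof. by rewrite /spec_f /spec_lambda (mulrC p). Qed.

(* The hypotheses [z != 1] and [z != a - 1] are corrections: for those two
   starting points the one-step hitting term is missing from the series, the
   right-hand side is not the ruin probability, and for a = 2 it is 0 / 0. *)
Theorem mainTheorem2 (R : realType) (d : measure_display)
  (T : measurableType d) (P : probability T R)
  (a z : nat) (hz : (1 <= z <= a - 1)%N)
  (hz1 : z != 1%N) (hza : z != (a - 1)%N)
  (p q : R) (hp : 0 < p < 1) (hq : q = 1 - p)
  (gamma : R) (hgamma : 0 < gamma < 1)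
  (rho : nat -> {RV P >-> bool}) (xi : nat -> {RV P >-> R})
  (hinputs : reset_walk_inputs gamma p q rho xi) :
  P (ruin_event a z rho xi) =
  ((\sum_(1 <= nu < a) spec_A a z p q nu * spec_f a p q gamma nu) /
   (\sum_(1 <= nu < a)
      (spec_A a z p q nu + spec_B a z p q nu) * spec_f a p q gamma nu))%:E.
Proof.
have /andP[p0 p1] := hp; have /andP[g0 g1] := hgamma.
have q0 : 0 < q by rewrite hq; lra.
have pq1 : p + q = 1 by rewrite hq; ring.
have qp1 : q + p = 1 by rewrite hq; ring.
have s01 : 0 < 1 - gamma < 1 by apply/andP; split; lra.
have za : (0 < z < a)%N by lia.
have a0 : (0 < a)%N by lia.
rewrite hq in hinputs.
pose h0 := discounted_ruin a p q (1 - gamma).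
pose ha x := discounted_ruin a q p (1 - gamma) (a - x).
have cvgk := occupation_ruin_cvg a z p gamma za hp hgamma h0 ha erefl.
have {}cvgk : (fun n => occupation a z p gamma n ord0) @ \oo --> h0 z / (h0 z + ha z).
  apply: cvgk.
  - exact: discounted_ruin_end.
  - by rewrite /ha subn0; exact: discounted_ruin_end.
  - by rewrite /ha subnn.
  - by move=> x xa; rewrite -hq; exact: discounted_ruin_rec.
  - move=> x xa; rewrite -hq /ha discounted_ruin_rec //; last by lia.
    (* Reflection exchanges successor and predecessor, which compensates for the exchange of [p] and
       [q]. *)
    have -> : (a - x).+1 = (a - x.-1)%N by lia.
    have -> : (a - x).-1 = (a - x.+1)%N by lia.
    by rewrite [q * _ + _]addrC.
have h0E : h0 z = Num.sqrt (p * q) * (1 - gamma) *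
    \sum_(1 <= nu < a) spec_A a z p q nu * spec_f a p q gamma nu.
  (* Here [z != 1] gives [1 < z]; the reflected case below gets [1 < a - z] from [z != a - 1]. *)
  rewrite /h0 discounted_ruin_spec //; last by lia.
  by rewrite subKr.
have haE : ha z = Num.sqrt (p * q) * (1 - gamma) *
    \sum_(1 <= nu < a) spec_B a z p q nu * spec_f a p q gamma nu.
  rewrite /ha discounted_ruin_spec //; last by lia.
  rewrite (mulrC q) subKr; congr (_ * _); apply: eq_bigr => nu _.
  rewrite spec_B_reflect; last by lia.
  by rewrite (spec_f_swap R a q).
(* This prefactor is common to [h0 z] and [ha z] and cancels in the quotient. *)
have c0 : Num.sqrt (p * q) * (1 - gamma) != 0.
  by rewrite mulf_neq0 ?gt_eqF ?sqrtr_gt0 ?mulr_gt0 // subr_gt0.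
transitivity (h0 z / (h0 z + ha z))%:E.
  apply: cvg_unique (probability_ruin_cvg P a z p gamma za rho xi hinputs) _ => //.
  by apply: cvg_EFin => //; exact: nearW.
congr EFin; rewrite h0E haE -mulrDr -mulf_div divff // mul1r -big_split /=.
by congr (_ / _); apply: eq_bigr => nu _; rewrite mulrDl.
Qed.
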